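(* Let $M$ be a complex antidiagonalizable matrix that is unitarily similar to its Jordan canonical form. (a) $M^2$ is normal. (b) If each eigenvalue of $M$ is real or pure imaginary, then $M^2$ is Hermitian. (c) If $M$ has a real spectrum, then $M^2$ is a positive semidefinite Hermitian matrix. (d) If $M$ has a pure imaginary spectrum, then $M^2$ is a negative semidefinite Hermitian matrix.
   Context: A matrix of size $n$ is antidiagonal if its only nonzero entries are at positions $(i,n+1-i)$, and antidiagonalizable if it is similar to an antidiagonal matrix. Unitarily similar means $M=UJU^{-1}$ with $U$ unitary. *)

(* Defs.v *)
From mathcomp Require Import all_boot all_order all_algebra.
From mathcomp Require Import reals.
From mathcomp.real_closed Require Export complex.

Set Implicit Arguments.
Unset Strict Implicit.
Unset Printing Implicit Defensive.

Import Order.TTheory GRing.Theory Num.Theory.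
Local Open Scope ring_scope.
Local Open Scope sesquilinear_scope.

(* With indices starting at 0, position (i, n + 1 - i) is (i, rev_ord i). *)
Definition is_antidiag_mx (F : fieldType) (n : nat) (A : 'M[F]_n) : bool :=
  [forall i, forall j, (A i j != 0) ==> (j == rev_ord i)].

Definition antidiagonalizable (F : fieldType) (n : nat) (A : 'M[F]_n) : Prop :=
  A ~_{in unitmx} {in @is_antidiag_mx F n}.

Definition jordan_block (F : fieldType) (m : nat) (a : F) : 'M[F]_m :=
  \matrix_(i, j) (a *+ (j == i :> nat) + (j == i.+1 :> nat)%:R).

(* The cast identifies n with the sum of the sizes of the blocks. *)
Definition jordan_mx (F : fieldType) (n : nat) (J : 'M[F]_n) : Prop :=
  exists (k : nat) (p : 'I_k -> nat) (a : 'I_k -> F)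
         (e : (\sum_i p i)%N = n),
    (forall i, (0 < p i)%N) /\
    J = castmx (e, e) (\mxdiag_i jordan_block (p i) (a i)).

(* The Jordan canonical form of a matrix is only determined up to the order of
   its blocks, hence a relation. *)
Definition jordan_form (F : fieldType) (n : nat) (M J : 'M[F]_n) : Prop :=
  jordan_mx J /\ M ~_{in unitmx} J.

Definition unitarily_similar (C : numClosedFieldType) (n : nat)
    (M J : 'M[C]_n) : Prop :=
  exists2 U : 'M[C]_n, U \is unitarymx & M = U *m J *m invmx U.

Definition possemidef_mx (C : numClosedFieldType) (n : nat) (A : 'M[C]_n) :
    Prop :=
  forall v : 'cV[C]_n, 0 <= (v ^t* *m A *m v) 0 0.

Definition negsemidef_mx (C : numClosedFieldType) (n : nat) (A : 'M[C]_n) :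
    Prop :=
  forall v : 'cV[C]_n, (v ^t* *m A *m v) 0 0 <= 0.

(* Main.v *)
(* The square of an antidiagonal matrix is diagonal, so M ^+ 2, and hence
   J ^+ 2, is diagonalizable.  The square of a Jordan block with eigenvalue a
   is a ^+ 2 plus a strictly upper triangular matrix, so diagonalizability
   forces each squared block to be scalar: J ^+ 2 is diagonal.  Thus M ^+ 2 is
   unitarily diagonalizable, with squares of eigenvalues of M as diagonal
   entries. *)
Require Import Defs.
From mathcomp Require Import all_boot all_order all_algebra.
From mathcomp Require Import reals.
From mathcomp.real_closed Require Import complex.
Import Order.TTheory GRing.Theory Num.Theory.
Local Open Scope ring_scope.

(** Row [i] of [A] is supported at [rev_ord i], and [rev_ord] is an involution, so two steps lead
    back to [i]. *)
Lemma antidiag_mx_sq_diag (F : fieldType) (n : nat) (A : 'M[F]_n) :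
  is_antidiag_mx A -> is_diag_mx (A *m A).
Proof.
move=> /forallP A_anti.
have A0 i j : j != rev_ord i -> A i j = 0.
  by move=> ij; have /forallP/(_ j) := A_anti i; rewrite (negPf ij) implybF negbK => /eqP.
apply/is_diag_mxP => i j ij; rewrite !mxE big1 // => k _.
have [->|/A0->] := eqVneq k (rev_ord i); last by rewrite mul0r.
by rewrite [A _ j]A0 ?mulr0 // rev_ordK eq_sym.
Qed.

(* A diagonalizable matrix is von Neumann regular; unlike diagonalizability
   itself, regularity of A - c passes to the diagonal blocks for free. *)
Lemma conj_diag_regular (F : fieldType) (n : nat) (P A : 'M[F]_n) :
  P \in unitmx -> is_diag_mx (P *m A *m invmx P) ->
  exists Y, A *m A *m Y = A.
Proof.
move=> Pu /diag_mxP[d dE].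
have AE : A = invmx P *m diag_mx d *m P.
  by rewrite -dE -!mulmxA mulVmx // mulmx1 mulKmx.
(* As [0^-1 = 0], this is an entrywise pseudo-inverse: [d * d * e = d] holds even where [d]
   vanishes. *)
pose e : 'rV[F]_n := \row_i (d 0 i)^-1.
exists (invmx P *m diag_mx e *m P).
have ddeE : diag_mx d *m diag_mx d *m diag_mx e = diag_mx d.
  rewrite !mulmx_diag; congr diag_mx; apply/rowP => i; rewrite !mxE.
  by have [->|d0] := eqVneq (d 0 i) 0; rewrite ?mul0r // mulfK.
by rewrite AE -[in RHS]ddeE !mulmxA !mulmxK.
Qed.

(* E = E *m (E *m Y), so row i of E is a combination of the rows of E *m Y
   of index > i: all rows vanish, starting from the last one. *)
Lemma strict_upper_regular_eq0 (F : fieldType) (m : nat) (E Y : 'M[F]_m) :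
  (forall i j : 'I_m, (j <= i)%N -> E i j = 0) -> E *m E *m Y = E -> E = 0.
Proof.
move=> E_up EEY.
suff row0 k (i : 'I_m) : (m - i <= k)%N -> row i E = 0.
  by apply/row_matrixP => i; rewrite (row0 m) ?leq_subr ?row0 // linear0.
elim: k i => [|k IHk] i ik.
  by move: ik; rewrite leqn0 subn_eq0 leqNgt ltn_ord.
rewrite -EEY -mulmxA row_mul mulmx_sum_row big1 // => l _; rewrite mxE.
have [/E_up->|il] := leqP l i; first by rewrite scale0r.
by rewrite row_mul IHk ?mul0mx ?scaler0 // -ltnS (leq_trans _ ik) // ltn_sub2l.
Qed.

Lemma jordan_block_sq_strict_upper (F : fieldType) (m : nat) (a : F)
    (i j : 'I_m) : (j <= i)%N ->
  (jordan_block m a *m jordan_block m a - (a ^+ 2)%:M) i j = 0.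
Proof.
(* Only [k = i] contributes: otherwise [k = i.+1], and then the entry at [(k, j)] vanishes because
   [j <= i < k]. *)
move=> ji; rewrite !mxE (bigD1 i) //= big1 ?addr0 => [|k ki]; last first.
  rewrite !mxE [k == i :> nat]val_eqE (negPf ki) mulr0n add0r.
  have [->|_] := eqVneq (k : nat) i.+1; last by rewrite mul0r.
  by rewrite ltn_eqF ?ltnS // ltn_eqF ?ltnS ?(leq_trans ji) // mulr0n addr0 mulr0.
rewrite !mxE eqxx ltn_eqF // addr0 mulr1n [_ == i.+1]ltn_eqF ?ltnS // addr0.
by rewrite mulrnAr -expr2 val_eqE eq_sym subrr.
Qed.

Lemma mul_mxdiag (F : fieldType) (k : nat) (p : 'I_k -> nat)
    (A B : forall i, 'M[F]_(p i)) :
  \mxdiag_i A i *m \mxdiag_i B i = \mxdiag_i (A i *m B i).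
Proof.
rewrite {2}/mxdiag mul_mxdiag_mxblock; apply/eq_mxblock => i j.
by have [<-|_] := eqVneq i j; rewrite ?conform_mx_id ?mulmx0.
Qed.

Lemma jordan_mx_sq_diag (F : fieldType) (n : nat) (P J : 'M[F]_n) :
  jordan_mx J -> P \in unitmx -> is_diag_mx (P *m (J *m J) *m invmx P) ->
  is_diag_mx (J *m J).
Proof.
move=> [k [p [a [e [_ JE]]]]] Pu; move: P J JE Pu.
case: n / e => P J; rewrite castmx_id => -> Pu.
rewrite mul_mxdiag => Dd.
suff BB i : jordan_block (p i) (a i) *m jordan_block (p i) (a i)
            = (a i ^+ 2)%:M.
  apply/is_diag_mxblockP; split=> [i j /negPf->//|i].
  by rewrite eqxx conform_mx_id BB scalar_mx_is_diag.
set S := \mxdiag_i _ in Dd.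
(* Subtracting a scalar matrix commutes with conjugation, so [P] still diagonalizes the
   difference. *)
have [|Y] := @conj_diag_regular _ _ P (S - (a i ^+ 2)%:M) Pu.
  rewrite mulmxBr mulmxBl scalar_mxC mulmxK //.
  have /diag_mxP[d ->] := Dd.
  by rewrite -diag_const_mx -linearB diag_mx_is_diag.
(* With [Y] cut into blocks, the [(i, i)] block of the identity involves only the [i]-th squared
   block minus [a i ^+ 2] and the [(i, i)] block of [Y]. *)
rewrite -mxdiagZ -mxdiagB mul_mxdiag -[Y]submxblockK mul_mxdiag_mxblock.
move/(congr1 (fun X => submxblock X i i)); rewrite mxblockK submxblock_diag.
move/strict_upper_regular_eq0 => E0; apply/eqP; rewrite -subr_eq0; apply/eqP.
by apply: E0 => x y; apply: jordan_block_sq_strict_upper.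
Qed.

Lemma eigenvalue_sqr (C : numClosedFieldType) (n : nat) (M : 'M[C]_n) (c : C) :
  eigenvalue (M *m M) c -> exists2 b, eigenvalue M b & c = b ^+ 2.
Proof.
(* v (M - s) (M + s) = 0 for s a square root of c, so either v (M - s) = 0, or
   v (M - s) is an eigenvector for - s. *)
move=> /eigenvalueP[v vMM v0]; pose s := sqrtC c.
have [vs|vs] := eqVneq (v *m M) (s *: v).
  by exists s; [apply/eigenvalueP; exists v | rewrite sqrtCK].
exists (- s); last by rewrite sqrrN sqrtCK.
apply/eigenvalueP; exists (v *m M - s *: v); last by rewrite subr_eq0.
rewrite mulmxBl -mulmxA vMM -scalemxAl scalerBr scalerA mulNr -expr2 sqrtCK.
by rewrite !scaleNr opprK addrC.
Qed.

Lemma unitary_diag_eigenvalue (C : numClosedFieldType) (n : nat)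
    (U : 'M[C]_n) (d : 'rV[C]_n) (i : 'I_n) :
  U \is unitarymx -> eigenvalue (U *m diag_mx d *m invmx U) (d 0 i).
Proof.
move=> Uu; have Uunit := unitarymx_unit Uu.
(* Eigenvectors are row vectors here: row [i] of the inverse of [U] is one. *)
apply/eigenvalueP; exists (delta_mx 0 i *m invmx U).
  by rewrite -!mulmxA mulKmx // mulmxA -[_ *m diag_mx d]rowE row_diag_mx -scalemxAl.
apply/eqP => /(congr1 (mulmx^~ U)); rewrite mulmxKV // mul0mx.
by move/matrixP/(_ 0 i); rewrite !mxE !eqxx => /eqP; rewrite oner_eq0.
Qed.

Local Open Scope sesquilinear_scope.

Lemma trmxC_unitary_diag (C : numClosedFieldType) (n : nat)
    (U : 'M[C]_n) (d : 'rV[C]_n) :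
  U \is unitarymx ->
  (U *m diag_mx d *m invmx U)^t* =
    U *m diag_mx (map_mx Num.conj d) *m invmx U.
Proof.
move=> Uu; rewrite invmx_unitary // !trmx_mul !map_mxM trmxCK.
by rewrite tr_diag_mx map_diag_mx mulmxA.
Qed.

Lemma unitary_diag_normalmx (C : numClosedFieldType) (n : nat)
    (U : 'M[C]_n) (d : 'rV[C]_n) :
  U \is unitarymx -> U *m diag_mx d *m invmx U \is normalmx.
Proof.
move=> Uu; apply/normalmxP; rewrite trmxC_unitary_diag // !mulmxA.
rewrite !mulmxKV ?unitarymx_unit //.
by rewrite -[U *m _ *m _]mulmxA diag_mxC mulmxA.
Qed.

Lemma unitary_diag_hermsymmx (C : numClosedFieldType) (n : nat)
    (U : 'M[C]_n) (d : 'rV[C]_n) :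
  U \is unitarymx -> (forall i, d 0 i \is Num.real) ->
  U *m diag_mx d *m invmx U \is hermsymmx.
Proof.
move=> Uu d_real; apply/is_hermitianmxP.
rewrite expr0 scale1r trmxC_unitary_diag //.
suff -> : map_mx Num.conj d = d by [].
by apply/rowP => i; rewrite mxE; apply/CrealP.
Qed.

(** In the coordinates [invmx U *m v] the form is diagonal, so its semidefiniteness can be read off
    the signs of the entries of [d]. *)
Lemma unitary_diag_form (C : numClosedFieldType) (n : nat)
    (U : 'M[C]_n) (d : 'rV[C]_n) (v : 'cV[C]_n) :
  U \is unitarymx ->
  (v ^t* *m (U *m diag_mx d *m invmx U) *m v) 0 0 =
    \sum_i d 0 i * `|(invmx U *m v) i 0| ^+ 2.
Proof.
move=> Uu; set w := invmx U *m v.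
have -> : v ^t* *m (U *m diag_mx d *m invmx U) *m v = w ^t* *m (diag_mx d *m w).
  by rewrite /w trmx_mul map_mxM invmx_unitary // trmxCK !mulmxA.
rewrite mul_diag_mx mxE; apply: eq_bigr => i _.
by rewrite !mxE normCK mulrC -!mulrA.
Qed.

Theorem corollary5p11 (R : realType) (n : nat) (M : 'M[R[i]%C]_n)
    (M_antidiag : antidiagonalizable M)
    (M_unitary_jordan :
       exists2 J : 'M[R[i]%C]_n, jordan_form M J & unitarily_similar M J) :
  [/\ M ^+ 2 \is normalmx,
      (forall a : R[i]%C, eigenvalue M a -> a \is Num.real \/ 'Re a = 0) ->
        M ^+ 2 \is hermsymmx,
      (forall a : R[i]%C, eigenvalue M a -> a \is Num.real) ->
        M ^+ 2 \is hermsymmx /\ possemidef_mx (M ^+ 2)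
    & (forall a : R[i]%C, eigenvalue M a -> 'Re a = 0) ->
        M ^+ 2 \is hermsymmx /\ negsemidef_mx (M ^+ 2)].
Proof.
have [J [Jjordan _] [U Uu ME]] := M_unitary_jordan.
have Uunit := unitarymx_unit Uu.
have MME : M *m M = U *m (J *m J) *m invmx U.
  by rewrite ME !mulmxA mulmxKV.
have [Q Qu] := M_antidiag.
rewrite /simmx_to_for mxpoly.conjumx // => /antidiag_mx_sq_diag.
set A := Q *m M *m invmx Q => AAd.
(* [Q *m U] thus diagonalizes the square of the very [J] that is unitarily similar to [M]. *)
have AAE : A *m A = (Q *m U) *m (J *m J) *m invmx (Q *m U).
  apply: (canRL (mulmxK _)); first by rewrite unitmx_mul Qu.
  by rewrite /A !mulmxA !mulmxKV // -(mulmxA Q M M) MME !mulmxA mulmxKV.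
have /diag_mxP[d JJE] : is_diag_mx (J *m J).
  by apply: (@jordan_mx_sq_diag _ _ (Q *m U)); rewrite ?unitmx_mul ?Qu // -AAE.
have {MME}M2E : M ^+ 2 = U *m diag_mx d *m invmx U by rewrite -JJE -MME.
have dE i : exists2 b, eigenvalue M b & d 0 i = b ^+ 2.
  by apply: eigenvalue_sqr; rewrite -[M *m M]/(M ^+ 2) M2E unitary_diag_eigenvalue.
(* Here [b = 'i * 'Im b], whose square is minus the square of a real number. *)
have imag_sqr (b : R[i]%C) : 'Re b = 0 -> b ^+ 2 <= 0.
  move=> b0; rewrite [b]Crect b0 add0r exprMn sqrCi mulN1r oppr_le0.
  by rewrite real_exprn_even_ge0 ?Creal_Im.
have hermi :
    (forall a, eigenvalue M a -> a \is Num.real \/ 'Re a = 0) ->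
  M ^+ 2 \is hermsymmx.
  move=> Mev; rewrite M2E unitary_diag_hermsymmx // => i.
  have [b /Mev[breal|/imag_sqr b0] ->] := dE i; first exact: rpredX.
  exact: ler0_real.
split=> // [|Mreal|Mimag].
- by rewrite M2E unitary_diag_normalmx.
- split=> [|v]; first by apply: hermi => a /Mreal; left.
  rewrite M2E unitary_diag_form // sumr_ge0 // => i _.
  have [b /Mreal breal ->] := dE i.
  by apply: mulr_ge0; [rewrite real_exprn_even_ge0 | rewrite exprn_ge0].
- split=> [|v]; first by apply: hermi => a /Mimag; right.
  rewrite M2E unitary_diag_form // sumr_le0 // => i _.
  have [b /Mimag /imag_sqr b0 ->] := dE i.
  by rewrite mulr_le0_ge0 ?exprn_ge0.
Qed.
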